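(* Let $m_1,m_2\in\mathcal{N}$ be monomials with $x_{\alpha}m_{1}=x_{\beta}m_{2}$, where $\alpha,\beta\in\{0,1,\dots,n\}$, $x_0=1$, and at most one of $x_\alpha,x_\beta$ is equal to $x_0=1$. Then the S-polynomial $$x_{\alpha}\cdot\big(Y(m_{1})+\tau(m_{1})\big)-x_{\beta}\cdot\big(Y(m_{2})+\tau(m_{2})\big)$$ reduces to $0$ modulo $\mathcal{MG}^+=\{m+Y(m)+\tau(m)\mid m\in\mathcal{N}\}$; that is, its image under $\operatorname{red}$ is $0$.
   Context: $K$ is an algebraically closed field of characteristic $0$, $K[\mathbf{x}]=K[x_1,\dots,x_n]$, $\mathbb{T}^n$ is the set of monomials in $x_1,\dots,x_n$, $\mathbb{T}^n_d$ those of degree $d$. Monomial inequalities refer to lexicographic order with $x_1>\dots>x_n$ (on monomials of arbitrary degrees). Negative degree-lexicographic listing of monomials: $m$ comes before $m'$ iff $\deg m<\deg m'$, or $\deg m=\deg m'$ and $m>m'$. Admissible order ideal: fix integers $2\le r<s$ and monomials $\mathcal{W}_d\in\mathbb{T}^n_d$ for $r\le d\le s+1$ such that $\mathcal{W}_{s+1}=x_n^{s+1}$; $x_n\mathcal{W}_d\ge\mathcal{W}_{d+1}$ for $r\le d<s$; $\mathcal{W}_s>x_n^s$. Put $\mathcal{O}=\bigcup_{d=0}^{s+1}\mathcal{O}_d$, where $\mathcal{O}_d=\mathbb{T}^n_d$ for $d\le r-1$ and $\mathcal{O}_d=\{m\in\mathbb{T}^n_d\mid \mathcal{W}_d>m\}$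 for $r\le d\le s+1$. Border: $\partial\mathcal{O}=(\bigcup_k x_k\mathcal{O})\setminus\mathcal{O}$. List $\mathcal{O}=\{t_1,\dots,t_\mu\}$ and $\partial\mathcal{O}=\{b_1,\dots,b_\nu\}$ in negative degree-lexicographic order. $\mathcal{N}=\{m\in\mathbb{T}^n\mid r\le\deg m\le s+1,\ m\notin\mathcal{O}\}$, $\mathcal{N}_{\le s}=\{m\in\mathcal{N}\mid\deg m\le s\}$; $\operatorname{LM}=\{b\in\partial\mathcal{O}\mid\deg b\le s,\ x_k\mid b\Rightarrow b/x_k\in\mathcal{O}\ \forall k\}$; $\operatorname{TM}=\mathcal{O}_s$. $\mathcal{C}=\{C_{i,j}\mid t_i\in\operatorname{TM},\ b_j\in\operatorname{LM}\}$ are indeterminates. For a monomial $m\notin\mathcal{O}$ put $Y(m)=-\sum_{t_i\in\operatorname{TM}}C_{i,j}t_i$ if $m=b_j\in\operatorname{LM}$ and $Y(m)=0$ otherwise. $\operatorname{lv}(m)$ is the largest variable dividing $m$ and $\operatorname{ld}(m)$ its exponent in $m$. $x_k$ is a key variable if $x_k=\operatorname{lv}(m)$ for some $m\in\mathcal{N}_{\le s}$; then the key monomial $\chi_k$ is the lex-minimal element of $\{m'\in\operatorname{LM}\mid\operatorname{lv}(m')=x_k\}$, written $\chi_k=x_k^{e_k}\hat m_k$ with $e_k=\operatorname{ld}(\chi_k)$. Target seed monomials: $\mathcal{T}_k=\{t/\hat m_k\mid t\in\mathcal{O},\ \deg t\ge\deg\chi_k,\ \hat m_k\mid t,\text{ and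 }\chi_k\in\operatorname{LM}\Rightarrow t\notin\operatorname{TM}\}=\{t_{k,1},\dots,t_{k,\rho_k}\}$. $\Theta=\{\theta_{k,q}\mid x_k\text{ key},1\le q\le\rho_k\}$ are further indeterminates, $\sigma_k=\sum_q\theta_{k,q}t_{k,q}$, and $R=K[\mathcal{C},\Theta]$. Initial target of $m\in\mathcal{N}$: if $\deg m\le s$ and $\operatorname{lv}(m)=x_k$, then $\tau'(m)$ is $(m/x_k^{e_k})\cdot\sigma_k$ with all terms of degree $\ge s+1$ deleted (here $\operatorname{ld}(m)\ge e_k$); if $\deg m=s+1$, $\tau'(m)=0$. Targets $\tau(m)\in\operatorname{Span}_R(\mathcal{O})$, $m\in\mathcal{N}$, are defined recursively, from the last to the first element of $\mathcal{N}$ in negative degree-lexicographic order: $\tau(m)$ is obtained from $\tau'(m)$ by replacing each monomial $m'\notin\mathcal{O}$ occurring in it by $-(Y(m')+\tau(m'))$ (each such $m'$ lies in $\mathcal{N}$ and comes after $m$). For monomials of degree $\ge s+1$ one sets $\tau'=\tau=0$ and $Y=0$. Reduction: $\operatorname{red}:R[\mathbf{x}]\to\operatorname{Span}_R(\mathcal{O})$ is the $R$-linear map with $\operatorname{red}(t)=t$ for $t\in\mathcal{O}$ and $\operatorname{red}(m)=-(Y(m)+\tau(m))$ for monomials $m\notin\mathcal{O}$. ''$f$ reduces to $g$ modulo $\mathcal{MG}^+$'' means $\operatorname{red}(f)=g$. *)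

(* Defs.v *)
From HB Require Import structures.
From mathcomp Require Export all_boot all_order all_algebra.
From mathcomp.multinomials Require Export mpoly.

Set Implicit Arguments.
Unset Strict Implicit.
Unset Printing Implicit Defensive.

Import Order.TTheory GRing.Theory.
Local Open Scope ring_scope.

(* The variables x_1 > ... > x_n are U_(0), ..., U_(n-1) : 'X_{1..n}, so a
   larger variable has a smaller index. *)
Section Monomials.
Variable n : nat.
Implicit Types m b t : 'X_{1..n}.

(* Lexicographic order on exponent vectors; multinomials' own order on 'X_{1..n}
   compares total degrees first, hence cannot be used here. *)
Definition lexle m m' : bool := ((m : n.-tuplelexi nat) <= m')%O.
Definition lexlt m m' : bool := ((m : n.-tuplelexi nat) < m')%O.

(* Negative degree-lexicographic listing: m is listed no later than m'. *)
Definition ndeglex m m' : bool :=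
  (mdeg m < mdeg m')%N || ((mdeg m == mdeg m') && lexle m' m).

(* x_n as a monomial. *)
Definition xlast : 'X_{1..n} := [multinom (i.+1 == n : nat) | i < n].

(* x_0 = 1 is None. *)
Definition xvar (a : option 'I_n) : 'X_{1..n} :=
  if a is Some k then U_(k)%MM else 0%MM.

(* Largest variable (None only for the monomial 1) and its exponent. *)
Definition lv m : option 'I_n :=
  [pick k | (0 < m k)%N && [forall j : 'I_n, (j < k)%N ==> (m j == 0)%N]].
Definition ld m : nat := if lv m is Some k then m k else 0%N.

End Monomials.

(* For n = 0 no family W satisfies this, since xlast is then 1. *)
Definition admissible (n r s : nat) (W : nat -> 'X_{1..n}) : Prop :=
  [/\ (2 <= r < s)%N,
      forall d, (r <= d <= s.+1)%N -> mdeg (W d) = d,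
      W s.+1 = (xlast n *+ s.+1)%MM,
      forall d, (r <= d < s)%N -> lexle (W d.+1) (xlast n + W d)%MM
    & lexlt (xlast n *+ s)%MM (W s)].

Section Ideal.
Variables (n r s : nat) (W : nat -> 'X_{1..n}).
Implicit Types m b t : 'X_{1..n}.

Definition inO m : bool :=
  (mdeg m <= s.+1)%N && ((mdeg m < r)%N || lexlt m (W (mdeg m))).

Definition in_border m : bool :=
  ~~ inO m && [exists k : 'I_n, (0 < m k)%N && inO (m - U_(k))%MM].

Definition inN m : bool := (r <= mdeg m <= s.+1)%N && ~~ inO m.

Definition inNs m : bool := inN m && (mdeg m <= s)%N.

Definition inLM b : bool :=
  [&& in_border b, (mdeg b <= s)%N
    & [forall k : 'I_n, (0 < b k)%N ==> inO (b - U_(k))%MM]].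

Definition inTM t : bool := inO t && (mdeg t == s).

(* All monomials of degree at most s+1; this bounds O, its border and N. *)
Definition mons : seq 'X_{1..n} := [seq bmnm m | m : 'X_{1..n < s.+2}].

Definition LMs : seq 'X_{1..n} := [seq b <- mons | inLM b].
Definition TMs : seq 'X_{1..n} := [seq t <- mons | inTM t].
Definition Ns : seq 'X_{1..n} := sort (@ndeglex n) [seq m <- mons | inN m].

Definition key (k : 'I_n) : bool :=
  has (fun m => inNs m && (lv m == Some k)) mons.

(* The lex-minimal element; for W admissible and x_k key the default is not used,
   since LM then contains a power of x_k. *)
Definition chi (k : 'I_n) : 'X_{1..n} :=
  head 0%MM (sort (@lexle n) [seq b <- LMs | lv b == Some k]).

Definition ek (k : 'I_n) : nat := ld (chi k).

Definition mhat (k : 'I_n) : 'X_{1..n} := (chi k - U_(k) *+ ek k)%MM.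

Definition seeds (k : 'I_n) : seq 'X_{1..n} :=
  if key k then
    [seq (t - mhat k)%MM | t <- mons
       & [&& inO t, (mdeg (chi k) <= mdeg t)%N, (mhat k <= t)%MM
           & inLM (chi k) ==> ~~ inTM t]]
  else [::].

(* The indeterminates: C_(t, b) for t in TM and b in LM, and theta_(k, t) for
   x_k key and t a target seed monomial of x_k.  They are indexed by the
   monomials themselves rather than by positions in a listing. *)
Definition indet : finType :=
  ((seq_sub TMs * seq_sub LMs) + {k : 'I_n & seq_sub (seeds k)})%type.

End Ideal.

Section Targets.
Variables (K : closedFieldType) (n r s : nat) (W : nat -> 'X_{1..n}).
Implicit Types m b t : 'X_{1..n}.

Local Notation R := {mpoly K[#|indet r s W|]}.
Local Notation P := {mpoly R[n]}.

Definition C (t : seq_sub (TMs r s W)) (b : seq_sub (LMs r s W)) : R :=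
  'X_(enum_rank (inl (t, b) : indet r s W)).

Definition theta (k : 'I_n) (t : seq_sub (seeds r s W k)) : R :=
  'X_(enum_rank (inr (Tagged (fun k => seq_sub (seeds r s W k)) t) : indet r s W)).

Definition Y m : P :=
  if (insub m : option (seq_sub (LMs r s W))) is Some b
  then - \sum_(t : seq_sub (TMs r s W)) C t b *: 'X_[val t]
  else 0.

Definition sigma (k : 'I_n) : P :=
  \sum_(t : seq_sub (seeds r s W k)) theta t *: 'X_[val t].

Definition init_target m : P :=
  if (mdeg m <= s)%N then
    if lv m is Some k then
      let p : P := 'X_[(m - U_(k) *+ ek r s W k)%MM] * sigma k in
      \sum_(m' <- msupp p | (mdeg m' <= s)%N) p@_m' *: 'X_[m']
    else 0
  else 0.

(* R-linear: fixes O and sends a monomial m outside O to - (Y m + tau m). *)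
Definition rewrite_with (tau : 'X_{1..n} -> P) (p : P) : P :=
  \sum_(m <- msupp p)
    p@_m *: (if inO r s W m then 'X_[m] else - (Y m + tau m)).

(* foldr treats the listing Ns from its last to its first element; at the step
   for m, the accumulator f holds the targets of the elements listed after m
   and is 0 elsewhere. In particular target vanishes in degree > s+1. *)
Definition target : 'X_{1..n} -> P :=
  foldr (fun m f m' => if m' == m then rewrite_with f (init_target m) else f m')
        (fun _ => 0) (Ns r s W).

Definition red (p : P) : P := rewrite_with target p.

End Targets.

Arguments C K {n r s W} t b.
Arguments theta K {n r s W k} t.
Arguments Y K {n} r s W m.
Arguments sigma K {n} r s W k.
Arguments init_target K {n} r s W m.
Arguments rewrite_with K {n} r s W tau p.
Arguments target K {n} r s W m.
Arguments red K {n} r s W p.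

(* Main.v *)
From HB Require Import structures.
Require Import Defs.
From mathcomp Require Import all_boot all_order all_algebra zify.
From mathcomp.multinomials Require Import mpoly.

(* Write nf m for the image of the monomial m under red. The claim is that
   red (u * nf m) = nf (u * m) for all monomials u and m; both halves of the
   S-polynomial then reduce to - nf (x_alpha m_1) = - nf (x_beta m_2). The claim is
   proved by induction on m, from the last monomial to the first, and then for u = x_j
   from the smallest variable to the largest. Let x_k = lv m and w = m / x_k^(e_k), so
   that nf m is - Y m - red (w sigma_k), where Y m contributes nothing after
   multiplication by x_j. If x_j <= x_k, then x_j m has initial target x_j w sigma_k.
   If x_j > x_k, the lex-segment shape of O forces e_j = 1; the seeds of x_j only
   involve variables smaller than x_j and those of x_k only variables up to x_k, whence
   nf (x_j m) = - red (m sigma_j) = red (w sigma_k sigma_j), and also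
   red (x_j nf m) = - red (x_j w sigma_k) = red (w sigma_k sigma_j). *)

Set Implicit Arguments.
Unset Strict Implicit.
Unset Printing Implicit Defensive.

Import Order.TTheory GRing.Theory.
Local Open Scope ring_scope.

(** * Lexicographic order and largest variables *)

Section LexOrder.
Variable n : nat.
Implicit Types m u : 'X_{1..n}.

Lemma lexltP m m' :
  reflect (exists2 k : 'I_n, forall i : 'I_n, (i < k)%N -> m i = m' i & (m k < m' k)%N)
          (lexlt m m').
Proof. exact: ltxi_tuplePlt. Qed.

Lemma lexltNge m m' : lexlt m m' = ~~ lexle m' m.
Proof. exact: ltNge. Qed.

Lemma lexleNgt m m' : lexle m m' = ~~ lexlt m' m.
Proof. exact: leNgt. Qed.

Lemma lexle_trans : transitive (@lexle n).
Proof. by move=> y x z; apply: le_trans. Qed.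

Lemma lexle_total : total (@lexle n).
Proof. by move=> x y; apply: le_total. Qed.

Lemma lexlt_add2l u m m' : lexlt (u + m) (u + m') = lexlt m m'.
Proof.
apply/lexltP/lexltP => -[k eqk ltk]; exists k.
- by move=> i /eqk; rewrite !mnmDE => /addnI.
- by move: ltk; rewrite !mnmDE ltn_add2l.
- by move=> i /eqk; rewrite !mnmDE => ->.
- by rewrite !mnmDE ltn_add2l.
Qed.

Lemma lexle_add2l u m m' : lexle (u + m) (u + m') = lexle m m'.
Proof. by rewrite !lexleNgt lexlt_add2l. Qed.

Lemma xlastE (i k : 'I_n) : (i < k)%N -> xlast n i = 0%N.
Proof. by move=> ltik; rewrite mnmE; case: eqP => //; have := ltn_ord k; lia. Qed.

Lemma mdeg_xlast (i : 'I_n) : mdeg (xlast n) = 1%N.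
Proof.
case: n i => [[] //|n' _]; rewrite mdegE (bigD1 ord_max) //= mnmE eqxx big1 // => i.
by rewrite -val_eqE /= mnmE eqSS => /negPf->.
Qed.

(** If u were lex-smaller than x_n^d with d = deg u, the first difference would sit at x_n, which
    forces u to be a power of x_n of the same degree. *)
Lemma lexle_xlast u : lexle (xlast n *+ mdeg u) u.
Proof.
rewrite lexleNgt; apply/negP => /lexltP [k eqk].
rewrite mulmnE mnmE; case: eqP => // kn; rewrite mul1n mdegE (bigD1 k) //= big1.
  by rewrite addn0 ltnn.
move=> i neik; have ltik : (i < k)%N.
  by move: neik; rewrite -val_eqE /=; have := ltn_ord i; lia.
by rewrite eqk // mulmnE (xlastE ltik).
Qed.

Lemma lvP m (k : 'I_n) :
  reflect ((0 < m k)%N /\ forall j : 'I_n, (j < k)%N -> m j = 0%N) (lv m == Some k).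
Proof.
have lvE k' : (0 < m k')%N && [forall j : 'I_n, (j < k')%N ==> (m j == 0%N)] ->
    (0 < m k')%N /\ forall j : 'I_n, (j < k')%N -> m j = 0%N.
  by case/andP=> mk /forallP h; split=> // j ltj; apply/eqP; have := h j; rewrite ltj.
rewrite /lv; case: pickP => [k' /lvE [mk' h']|none]; apply: (iffP eqP) => //.
- by case=> <-.
- case=> mk h; congr Some; apply/val_inj; case: (ltngtP k' k) => // [/h|/h'] /eqP.
    by rewrite eqn0Ngt mk'.
  by rewrite eqn0Ngt mk.
- case=> mk h; have := none k; rewrite mk /=; case: forallP => // [[]] j.
  by apply/implyP => /h ->.
Qed.

Lemma lv_neq0 m : m != 0%MM -> exists k, lv m == Some k.
Proof.
move=> m0; have [i mi] : exists i : 'I_n, (0 < m i)%N.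
  apply/existsP; apply: contraNT m0; rewrite negb_exists => /forallP h.
  by apply/eqP/mnmP => i; rewrite mnm0E; have := h i; rewrite lt0n negbK => /eqP.
case: (@arg_minnP _ i (fun i => 0 < m i)%N (@nat_of_ord n) mi) => k mk min_k.
exists k; apply/lvP; split=> // j ltjk; apply/eqP; rewrite -leqn0 leqNgt.
by apply/negP => /min_k; rewrite leqNgt ltjk.
Qed.

End LexOrder.

(** * Admissible order ideals and their complements *)

Section AdmissibleIdeal.
Variables (n r s : nat) (W : nat -> 'X_{1..n}).
Hypothesis adm : admissible r s W.
Implicit Types m b t u w : 'X_{1..n}.

Local Notation inO := (inO r s W).
Local Notation inLM := (inLM r s W).

(** [W s.+1] is x_n^(s+1), the lex-smallest monomial of its degree, so nothing of degree s+1 lies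
    below it. *)
Lemma inO_deg m : inO m -> (mdeg m <= s)%N.
Proof.
case: adm => _ _ Ws _ _; rewrite /Defs.inO => /andP [].
rewrite leq_eqVlt ltnS => /orP [/eqP ds|//].
have [/andP[r2 rs] _ _ _ _] := adm.
rewrite ds Ws ltnNge (leq_trans (ltnW rs)) //= lexltNge -ds.
by rewrite lexle_xlast.
Qed.

Lemma notinO_deg m : ~~ inO m -> (r <= mdeg m)%N.
Proof.
have [/andP[r2 rs] _ _ _ _] := adm; apply: contraR; rewrite -ltnNge => lt_r.
by rewrite /Defs.inO lt_r (leq_trans (ltnW lt_r)) // (leq_trans (ltnW rs)).
Qed.

Lemma notinO_gt0 m : ~~ inO m -> (0 < mdeg m)%N.
Proof. have [/andP[r2 rs] _ _ _ _] := adm; move/notinO_deg; lia. Qed.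

Lemma W_chain d e : (r <= d)%N -> (d + e <= s)%N -> lexle (W (d + e)) (W d + xlast n *+ e)%MM.
Proof.
have [_ _ _ Wd _] := adm; move=> rd; elim: e => [|e IHe] le_s.
  by rewrite addn0 mulm0n addm0; apply: lexx.
rewrite addnS in le_s *; apply: lexle_trans (Wd _ _) _; first by lia.
by rewrite mulmSr addmA [X in lexle _ X]addmC lexle_add2l IHe // ltnW.
Qed.

(* Multiplication by x_n is the lex-smallest way to raise the degree. *)
Lemma notinO_up m m' : ~~ inO m -> (mdeg m <= mdeg m')%N ->
  lexle (m + xlast n *+ (mdeg m' - mdeg m))%MM m' -> ~~ inO m'.
Proof.
move=> mO le_d le_lex; apply/negP => m'O; have le_s := inO_deg m'O.
move: mO; rewrite /Defs.inO (leq_trans le_d (leqW le_s)) /= negb_or -leqNgt.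
case/andP=> rd; rewrite lexltNge negbK => Wm.
move: m'O; rewrite /Defs.inO (leqW le_s) ltnNge (leq_trans rd le_d) /=.
rewrite lexltNge => /negP; apply.
rewrite -[in W _](subnKC le_d); apply: lexle_trans (W_chain rd _) _.
  by rewrite subnKC.
by apply: lexle_trans le_lex; rewrite ![(_ + xlast n *+ _)%MM]addmC lexle_add2l.
Qed.

Lemma notinOD u m : ~~ inO m -> ~~ inO (u + m)%MM.
Proof.
move=> mO; apply: notinO_up (mO) _ _; rewrite mdegD ?leq_addl // addnK.
by rewrite [(u + m)%MM]addmC lexle_add2l lexle_xlast.
Qed.

Lemma notinO_le m m' : (m <= m')%MM -> ~~ inO m -> ~~ inO m'.
Proof. by move/submK<-; apply: notinOD. Qed.

(* The condition j.+1 < n excludes x_n: the power of x_n in notinO_up must not involve x_j. *)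
Lemma notinO_lex m m' (j : 'I_n) : ~~ inO m -> (mdeg m <= mdeg m')%N ->
  (forall i : 'I_n, (i <= j)%N -> m i = 0%N) -> (j.+1 < n)%N -> (0 < m' j)%N -> ~~ inO m'.
Proof.
move=> mO le_d m0 jn m'j; apply: notinO_up (mO) le_d _; rewrite lexleNgt.
apply/negP => /lexltP [i eq_i]; rewrite mnmDE mulmnE => lt_i.
have xl0 (i' : 'I_n) : (i' <= j)%N -> xlast n i' = 0%N.
  by move=> le_i; apply: (@xlastE _ _ (Ordinal jn)).
case: (leqP i j) => [le_ij|lt_ji]; first by move: lt_i; rewrite m0 // xl0 // mul0n.
by move: m'j; rewrite eq_i // mnmDE mulmnE m0 // xl0.
Qed.

(** W_s > x_n^s puts x_n^s into O, and by [notinOD] its divisors then lie in O too. *)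
Lemma xlast_inO d : (d <= s)%N -> inO (xlast n *+ d)%MM.
Proof.
move=> le_s; have [/andP[r2 rs] degW _ _ Ws] := adm.
(* For n = 0 all degrees are 0, against deg W_s = s > 0. *)
have mdegx : mdeg (xlast n) = 1%N.
  have : mdeg (W s) = s by apply: degW; rewrite ltnW //= leqnSn.
  case: (n) (W) => [W' |n' _ _]; last exact: (mdeg_xlast ord0).
  by rewrite mdegE big_ord0; lia.
suff h : inO (xlast n *+ s)%MM.
  apply: contraTT h => /(@notinOD (xlast n *+ (s - d))%MM).
  suff -> : (xlast n *+ (s - d) + xlast n *+ d = xlast n *+ s)%MM by [].
  by apply/mnmP => i; rewrite mnmDE !mulmnE -mulnDr subnK.
by rewrite /Defs.inO mdegMn mdegx mul1n leqnSn Ws orbT.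
Qed.

Lemma inLM_notinO b : inLM b -> ~~ inO b.
Proof. by case/and3P => /andP[]. Qed.

Lemma inLM_deg b : inLM b -> (mdeg b <= s)%N.
Proof. by case/and3P. Qed.

(** A monomial outside O that is not in LM stays outside O after division by a suitable variable;
    this descent ends in LM. *)
Lemma LM_min m : ~~ inO m -> (mdeg m <= s)%N -> exists2 b, inLM b & (b <= m)%MM.
Proof.
elim/ltn_ind: {m}(mdeg m) {-2}m (erefl (mdeg m)) => d IH m md mO le_s.
case: (boolP (inLM m)) => [mLM|]; first by exists m => //; apply/mnm_lepP.
case: (boolP [forall k : 'I_n, (0 < m k)%N ==> inO (m - U_(k))%MM]) => [all_k|].
  rewrite /Defs.inLM all_k le_s andbT /= /in_border mO /=.
  move/negP; case; rewrite andbT; apply/existsP; have [k /eqP lvm] : exists k, lv m == Some k.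
    by apply/lv_neq0; rewrite -mdeg_eq0; have := notinO_gt0 mO; lia.
  exists k; have /lvP [mk _] : lv m == Some k by apply/eqP.
  by rewrite mk /=; have /forallP/(_ k) := all_k; rewrite mk.
rewrite negb_forall => /existsP [k]; rewrite negb_imply => /andP [mk mkO] _.
have le_k : (U_(k) <= m)%MM.
  by apply/mnm_lepP => i; rewrite mnm1E; case: eqP => // <-.
have mdk : mdeg m = (mdeg (m - U_(k))%MM).+1 by rewrite -[in LHS](submK le_k) mdegD mdeg1 addn1.
have [||b bLM le_b] := IH (mdeg (m - U_(k))%MM) _ _ (erefl _) mkO; [by lia|by lia|].
by exists b => //; apply: lepm_trans le_b (lem_subr _ _).
Qed.

(** If an LM divisor b of m avoids x_k, it involves only smaller variables. Then x_k x_n^(deg b - 1)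
    is lex-larger of the same degree, hence outside O, and an LM divisor of it must contain x_k
    because x_n^(deg b - 1) is in O. *)
Lemma LM_lv m (k : 'I_n) : ~~ inO m -> (mdeg m <= s)%N -> lv m == Some k ->
  exists b, [/\ inLM b, lv b == Some k & (b k <= m k)%N].
Proof.
move=> mO le_s /lvP [mk m0]; have [b bLM /mnm_lepP le_b] := LM_min mO le_s.
have b0 (i : 'I_n) : (i < k)%N -> b i = 0%N by move/m0 => mi; have := le_b i; lia.
case: (posnP (b k)) => [bk|bk]; last by exists b; split=> //; apply/lvP.
have bO := inLM_notinO bLM; have bs := inLM_deg bLM.
have [l /lvP [bl bl0]] : exists l, lv b == Some l.
  by apply/lv_neq0; rewrite -mdeg_eq0; have := notinO_gt0 bO; lia.
have lt_kl : (k < l)%N.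
  rewrite ltnNge; apply/negP; rewrite leq_eqVlt => /orP [/eqP/val_inj lk|/b0].
    by move: bl; rewrite lk bk.
  by lia.
have kn : (k.+1 < n)%N by exact: leq_ltn_trans lt_kl (ltn_ord l).
pose v := (U_(k) + xlast n *+ (mdeg b).-1)%MM.
have vd : mdeg v = mdeg b.
  by rewrite mdegD mdeg1 mdegMn (mdeg_xlast k) mul1n add1n prednK // notinO_gt0.
have xk : xlast n k = 0%N by exact: xlastE lt_kl.
have vk : v k = 1%N by rewrite mnmDE mulmnE xk mnm1E eqxx.
have vO : ~~ inO v.
  apply: (@notinO_lex b v k) => //; rewrite ?vd ?vk // => i.
  by rewrite leq_eqVlt => /orP [/eqP/val_inj->|/b0].
have [|c cLM /mnm_lepP le_c] := LM_min vO; first by rewrite vd.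
exists c; suff ck : c k = 1%N.
  split=> //; last by rewrite ck.
  apply/lvP; rewrite ck; split=> // i lt_ik.
  have := le_c i; rewrite mnmDE mulmnE (xlastE lt_ik) mnm1E -val_eqE /= gtn_eqF //=.
  by lia.
have := le_c k; rewrite vk => le1; case: (posnP (c k)) => [ck0|]; last by lia.
have : ~~ inO (xlast n *+ (mdeg b).-1)%MM.
  apply: notinO_le (inLM_notinO cLM); apply/mnm_lepP => i.
  case: (i =P k) => [->|/eqP neik]; first by rewrite ck0.
  by have := le_c i; rewrite mnmDE mnm1E eq_sym (negPf neik).
by rewrite xlast_inO //; lia.
Qed.

Lemma mem_mons m : (m \in mons n s) = (mdeg m <= s.+1)%N.
Proof.
apply/mapP/idP => [[x _ ->]|le_s]; first by have := bmdeg x; rewrite ltnS.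
by exists (BMultinom (le_s : mdeg m < s.+2)%N); rewrite ?mem_enum.
Qed.

Lemma mem_LMs m : (m \in LMs r s W) = inLM m.
Proof. by rewrite mem_filter mem_mons andb_idr // => /inLM_deg/leqW. Qed.

(** * Key monomials and their seeds *)

Section Chi.
Variable k : 'I_n.

(** By [LM_lv] the sorted list is nonempty, so its head is never the default value. *)
Lemma chiP : key r s W k -> [/\ inLM (chi r s W k), lv (chi r s W k) == Some k
  & forall b, inLM b -> lv b == Some k -> lexle (chi r s W k) b].
Proof.
case/hasP => m _ /andP[/andP[/andP[_ mO] le_s] lvm].
have [b [bLM lvb _]] := LM_lv mO le_s lvm.
rewrite /chi; set l := [seq b <- _ | _]; pose l' := sort (@lexle n) l.
have memE c : (c \in l') = inLM c && (lv c == Some k).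
  by rewrite mem_sort mem_filter mem_LMs andbC.
have : sorted (@lexle n) l' := sort_sorted (@lexle_total n) l.
have : b \in l' by rewrite memE bLM.
rewrite -/l'; case: (l') memE => // c l'' memE _ /= sort_l.
have := memE c; rewrite mem_head => /esym /andP[cLM lvc]; split=> // d dLM lvd.
have : d \in c :: l'' by rewrite memE dLM.
rewrite inE => /predU1P [->|]; first exact: lexx.
by move/(allP (order_path_min (@lexle_trans n) sort_l)).
Qed.

Lemma keyP m : ~~ inO m -> (mdeg m <= s)%N -> lv m == Some k -> key r s W k.
Proof.
move=> mO le_s lvm; apply/hasP; exists m; first by rewrite mem_mons leqW.
by rewrite /inNs /Defs.inN (leqW le_s) notinO_deg // mO le_s.
Qed.

Lemma ekE : key r s W k -> ek r s W k = chi r s W k k.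
Proof. by case/chiP => _ /eqP lvc _; rewrite /ek /ld lvc. Qed.

Lemma ek_gt0 : key r s W k -> (0 < ek r s W k)%N.
Proof. by move=> kk; rewrite ekE //; case/chiP: kk => _ /lvP[]. Qed.

(** Among monomials with largest variable x_k, lex order compares exponents of x_k first. So e_k is
    the least such exponent in LM, and [LM_lv] transfers the bound to m. *)
Lemma ek_le m : ~~ inO m -> (mdeg m <= s)%N -> lv m == Some k -> (ek r s W k <= m k)%N.
Proof.
move=> mO le_s lvm; have kk := keyP mO le_s lvm.
have [b [bLM lvb]] := LM_lv mO le_s lvm; apply: leq_trans; rewrite ekE //.
case/chiP: kk => _ /lvP[_ c0] /(_ b bLM lvb); case/lvP: lvb => bk b0.
rewrite lexleNgt leqNgt; apply: contra => lt_k; apply/lexltP; exists k => // i lt_i.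
by rewrite c0 // b0.
Qed.

Hypothesis kk : key r s W k.
Local Notation e := (ek r s W k).
Local Notation chi := (chi r s W k).
Local Notation mhat := (mhat r s W k).

Lemma chi_mhat : chi = (U_(k) *+ e + mhat)%MM.
Proof.
apply/mnmP => i; rewrite mnmDE mnmBE mulmnE mnm1E ekE //.
by case: eqP => [->|_]; rewrite ?mul0n ?mul1n ?subnn ?addn0 ?add0n ?subn0.
Qed.

Lemma seedsP u : u \in seeds r s W k ->
  [/\ inO (u + mhat)%MM & (mdeg chi <= mdeg (u + mhat)%MM)%N].
Proof.
rewrite /seeds kk => /mapP [t]; rewrite mem_filter => /andP [/and4P[tO le_d le_t _] _ ->].
by rewrite submK.
Qed.

Lemma seed_deg u : u \in seeds r s W k -> (e <= mdeg u)%N.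
Proof. by case/seedsP => _; rewrite chi_mhat !mdegD mdegMn mdeg1 mul1n leq_add2r. Qed.

(** Otherwise [notinO_up], started from [chi], would push the element u + mhat out of O. *)
Lemma seed_lex u : u \in seeds r s W k ->
  lexlt (u + mhat)%MM (chi + xlast n *+ (mdeg (u + mhat) - mdeg chi))%MM.
Proof.
case/seedsP => tO le_d; rewrite lexltNge; apply: contraTN tO.
by apply: notinO_up => //; apply: inLM_notinO; case/chiP: kk.
Qed.

Lemma seed_var u (i : 'I_n) : u \in seeds r s W k -> (i < k)%N -> u i = 0%N.
Proof.
move=> /seed_lex /lexltP [l eq_l lt_l] lt_ik; have [_ /lvP[_ c0] _] := chiP kk.
have c0' (j : 'I_n) : (j < k)%N -> (chi + xlast n *+ (mdeg (u + mhat) - mdeg chi))%MM j = 0%N.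
  by move=> lt_j; rewrite mnmDE mulmnE c0 // (xlastE lt_j).
have le_kl : (k <= l)%N by rewrite leqNgt; apply/negP => /c0' E; rewrite E in lt_l.
by have := eq_l _ (leq_trans lt_ik le_kl); rewrite c0' // mnmDE; lia.
Qed.

Lemma seed_key u : u \in seeds r s W k -> (u k < e)%N.
Proof.
case/seedsP => tO _; rewrite ltnNge; apply: contraTN tO => le_e.
apply: (@notinO_le chi); last by apply: inLM_notinO; case/chiP: kk.
apply/mnm_lepP => i; rewrite chi_mhat !mnmDE leq_add2r mulmnE mnm1E.
by case: eqP => [<-|]; rewrite ?mul1n.
Qed.

End Chi.

(* Strictly later in the negative degree-lexicographic listing. *)
Definition later m m' : bool := ~~ ndeglex m' m.

Lemma laterE m m' : later m m' =
  (mdeg m < mdeg m')%N || ((mdeg m == mdeg m') && lexlt m' m).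
Proof. by rewrite /later /ndeglex lexltNge; case: ltngtP. Qed.

Lemma later_deg m m' : (mdeg m < mdeg m')%N -> later m m'.
Proof. by rewrite laterE => ->. Qed.

(** The new monomial times [chi] equals m times (u + mhat), so comparing it with m amounts to
    comparing u + mhat with [chi], as in [seed_lex]. This is why the recursion for targets only
    looks ahead. *)
Lemma seed_later m (k : 'I_n) u :
    ~~ inO m -> (mdeg m <= s)%N -> lv m == Some k -> u \in seeds r s W k ->
  later m (m - U_(k) *+ ek r s W k + u)%MM.
Proof.
move=> mO le_s lvm uk; have kk := keyP mO le_s lvm; have le_e := ek_le mO le_s lvm.
have le_m : (U_(k) *+ ek r s W k <= m)%MM.
  apply/mnm_lepP => i; rewrite mulmnE mnm1E.
  by case: eqP => [<-|]; rewrite ?mul1n.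
have [tO le_d] := seedsP kk uk; have := seed_lex kk uk.
set e := (_ *+ _)%MM in le_m *; set w := (m - e + u)%MM.
have wE : (chi r s W k + w = m + (u + mhat r s W k))%MM.
  rewrite chi_mhat // -/e /w -[in RHS](submK le_m).
  by apply/mnmP => i; rewrite !mnmDE; lia.
have := congr1 mdeg wE; rewrite (mdegD _ w) (mdegD m) => dE lt_lex.
rewrite laterE; case: ltngtP => // [lt_d|eq_d]; first by lia.
move: lt_lex; rewrite (_ : (_ - _)%N = 0%N) ?mulm0n ?addm0; last by lia.
by rewrite -(lexlt_add2l m) -wE [X in lexlt _ X]addmC lexlt_add2l.
Qed.

Lemma notinLMD (l : 'I_n) m : ~~ inO m -> ~~ inLM (U_(l) + m)%MM.
Proof.
move=> mO; apply/negP => /and3P [_ _ /forallP/(_ l)].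
rewrite mnmDE mnm1E eqxx /= addmC addmK => mO'.
by rewrite mO' in mO.
Qed.

(** As for LM, dividing x_j w by a variable of w leaves a multiple of x_j of degree at least deg m,
    again outside O by [notinO_lex]. *)
Lemma notin_up (j k : 'I_n) m w : ~~ inO m -> lv m == Some k -> (j < k)%N ->
    (mdeg m <= mdeg w)%N ->
  ~~ inO (U_(j) + w)%MM /\ ~~ inLM (U_(j) + w)%MM.
Proof.
move=> mO /lvP[mk m0] lt_jk le_d.
have jn : (j.+1 < n)%N by exact: leq_ltn_trans lt_jk (ltn_ord k).
have m0' (i : 'I_n) : (i <= j)%N -> m i = 0%N by move=> le_i; apply: m0; apply: leq_ltn_trans lt_jk.
split; first by apply: (notinO_lex mO _ m0'); rewrite // ?mnmDE ?mnm1E ?eqxx // mdegD; lia.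
have [l /lvP[wl _]] : exists l, lv w == Some l.
  by apply: lv_neq0; rewrite -mdeg_eq0; have := notinO_gt0 mO; lia.
have le_l : (U_(l) <= w)%MM by apply/mnm_lepP => i; rewrite mnm1E; case: eqP => // <-.
rewrite -(submK le_l) addmA addmC; apply: notinLMD.
apply: (notinO_lex mO _ m0') => //; last by rewrite mnmDE mnm1E eqxx.
by rewrite mdegD mdeg1; have := mdegD (w - U_(l)) U_(l); rewrite submK // mdeg1; lia.
Qed.

(* Below degree s + 1 the listing is finite, so its reverse is well-founded. *)
Lemma later_ind (P : 'X_{1..n} -> Prop) :
    (forall m, (s < mdeg m)%N -> P m) ->
    (forall m, (mdeg m <= s)%N -> (forall m', later m m' -> P m') -> P m) ->
  forall m, P m.
Proof.
move=> Pbig Pstep m; elim/ltn_ind: {m}(count (later m) (mons n s)) {-2}m (erefl (count (later m) (mons n s))).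
move=> c IH m mc; case: (leqP (mdeg m) s) => [le_s|]; last exact: Pbig.
apply: Pstep => // m' lat; case: (leqP (mdeg m') s) => [le_s'|]; last exact: Pbig.
apply: IH (erefl _); rewrite -mc.
have latT m'' : later m' m'' -> later m m''.
  move: lat; rewrite !laterE => /orP [lt1|/andP[/eqP eq1 l1]] /orP[lt2|/andP[/eqP eq2 l2]].
  - by rewrite (ltn_trans lt1).
  - by rewrite -eq2 lt1.
  - by rewrite eq1 lt2.
  - by rewrite eq1 eq2 eqxx /= [lexlt _ _](lt_trans l2 l1) orbT.
have nlat : ~~ later m' m' by rewrite laterE ltnn eqxx /= [lexlt _ _]ltxx.
(* The count drops strictly: m' is counted for m but not for itself. *)
have /splitPr : m' \in mons n s by rewrite mem_mons leqW.
case=> s1 s2; rewrite !count_cat /= lat (negPf nlat) add0n add1n addnS ltnS.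
by apply: leq_add; apply: sub_count.
Qed.

End AdmissibleIdeal.

(** * Linear extension of maps on monomials, and supports *)

Section LinearExtension.
Variables (n : nat) (R : comNzRingType).
Local Notation P := {mpoly R[n]}.
Implicit Types (m u : 'X_{1..n}) (p q : P) (f g : 'X_{1..n} -> P).

(** Every [rewrite_with], and hence [red], has this form. *)
Definition lext f p : P := \sum_(m <- msupp p) p@_m *: f m.

Lemma lext_seq f p (l : seq 'X_{1..n}) : uniq l -> {subset msupp p <= l} ->
  lext f p = \sum_(m <- l) p@_m *: f m.
Proof.
move=> uniq_l sub_l; rewrite [RHS](bigID (mem (msupp p))) /= [X in _ + X]big1 ?addr0.
  rewrite -big_filter; apply: perm_big; apply: uniq_perm; rewrite ?filter_uniq //.
  by move=> m; rewrite mem_filter; case: (boolP (m \in msupp p)) => // /sub_l.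
by move=> m; rewrite -mcoeff_eq0 => /eqP ->; rewrite scale0r.
Qed.

Fact lext_is_linear f : linear (lext f).
Proof.
move=> a p q; pose l := undup (msupp p ++ msupp q ++ msupp (a *: p + q)).
have sub_l p' : {subset msupp p' <= msupp p ++ msupp q ++ msupp (a *: p + q)} ->
    lext f p' = \sum_(m <- l) p'@_m *: f m.
  by move=> sub; apply: lext_seq; rewrite ?undup_uniq // => m /sub; rewrite mem_undup.
rewrite !sub_l => [|m|m|m]; rewrite ?mem_cat; try by move=> ->; rewrite ?orbT.
rewrite scaler_sumr -big_split; apply: eq_bigr => m _ /=.
by rewrite mcoeffD mcoeffZ scalerDl scalerA.
Qed.

HB.instance Definition _ f := GRing.isLinear.Build R P P _ (lext f) (lext_is_linear f).

Lemma lextX f m : lext f 'X_[m] = f m.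
Proof. by rewrite /lext msuppX big_seq1 mcoeffX eqxx scale1r. Qed.

Lemma lext_mul_sumX (I : finType) f p (c : I -> R) (w : I -> 'X_{1..n}) :
  lext f (p * \sum_i c i *: 'X_[w i]) = \sum_i c i *: lext f (p * 'X_[w i]).
Proof. by rewrite mulr_sumr linear_sum; apply: eq_bigr => i _; rewrite -scalerAr linearZ. Qed.

(** [A] takes values in [Prop] so that equations between polynomials can serve as conditions on the
    support. *)
Definition supp_in (A : 'X_{1..n} -> Prop) p := forall m, m \in msupp p -> A m.

Lemma eq_lext f g p : supp_in (fun m => f m = g m) p -> lext f p = lext g p.
Proof. by move=> eq_fg; apply: eq_big_seq => m /eq_fg ->. Qed.

Lemma lext_eq0 f p : supp_in (fun m => f m = 0) p -> lext f p = 0.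
Proof. by move=> f0; apply: big1_seq => m /andP[_ /f0 ->]; rewrite scaler0. Qed.

(** The hypothesis concerns only monomials of p, so an induction hypothesis about later monomials
    suffices to apply it. *)
Lemma lext_mul_lext f p u :
    supp_in (fun m => lext f ('X_[u] * f m) = f (u + m)%MM) p ->
  lext f ('X_[u] * lext f p) = lext f ('X_[u] * p).
Proof.
move=> mul_p; rewrite [in RHS](mpolyE p) [X in lext _ (_ * X) = _]/lext !mulr_sumr !linear_sum.
apply: eq_big_seq => m /mul_p mul_m /=.
by rewrite -!scalerAr !linearZ /= mul_m -mpolyXD lextX.
Qed.

Section Support.
Variable A : 'X_{1..n} -> Prop.

Lemma supp_in0 : supp_in A 0.
Proof. by move=> m; rewrite msupp0. Qed.

Lemma supp_inD p q : supp_in A p -> supp_in A q -> supp_in A (p + q).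
Proof. by move=> Ap Aq m /msuppD_le; rewrite mem_cat => /orP[/Ap|/Aq]. Qed.

Lemma supp_inN p : supp_in A p -> supp_in A (- p).
Proof. by move=> Ap m; rewrite (perm_mem (msuppN p)) => /Ap. Qed.

Lemma supp_inZ c p : supp_in A p -> supp_in A (c *: p).
Proof. by move=> Ap m /msuppZ_le /Ap. Qed.

Lemma supp_inX m : A m -> supp_in A 'X_[m].
Proof. by move=> Am m'; rewrite msuppX inE => /eqP->. Qed.

Lemma supp_in_sum (I : eqType) (l : seq I) (B : pred I) (F : I -> P) :
  (forall i, i \in l -> B i -> supp_in A (F i)) -> supp_in A (\sum_(i <- l | B i) F i).
Proof.
move=> AF; rewrite big_seq_cond; apply: big_ind => [|p q|i /andP[]].
- exact: supp_in0.
- exact: supp_inD.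
- exact: AF.
Qed.

Lemma supp_in_lext f p : supp_in (fun m => supp_in A (f m)) p -> supp_in A (lext f p).
Proof. by move=> Af; apply: supp_in_sum => m /Af Afm _; apply: supp_inZ. Qed.

Lemma supp_inXM u p : supp_in (fun m => A (u + m)%MM) p -> supp_in A ('X_[u] * p).
Proof. by move=> Ap m; rewrite mulrC (perm_mem (msuppMX p u)) => /mapP [m' /Ap Am' ->]. Qed.

End Support.

Lemma supp_inS (A B : 'X_{1..n} -> Prop) p :
  (forall m, A m -> B m) -> supp_in A p -> supp_in B p.
Proof. by move=> sub Ap m /Ap /sub. Qed.

End LinearExtension.

(** * Normal forms of monomials under reduction *)

Section NormalForm.
Variables (K : closedFieldType) (n r s : nat) (W : nat -> 'X_{1..n}).
Hypothesis adm : admissible r s W.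
Implicit Types m b t u w : 'X_{1..n}.

Local Notation R := {mpoly K[#|indet r s W|]}.
Local Notation P := {mpoly R[n]}.
Local Notation inO := (inO r s W).
Local Notation inLM := (inLM r s W).
Local Notation Y := (Y K r s W).
Local Notation target := (target K r s W).
Local Notation sigma := (sigma K r s W).
Local Notation ek := (ek r s W).
Local Notation init_target := (init_target K r s W).
Implicit Types p : P.

(* Locked, since unification would otherwise unfold the recursion defining target. *)
Definition nf m : P := locked (if inO m then 'X_[m] else - (Y m + target m)).
Local Notation red := (lext nf).

Lemma nf_inO m : inO m -> nf m = 'X_[m].
Proof. by rewrite /nf -lock => ->. Qed.

Lemma nf_notinO m : ~~ inO m -> nf m = - (Y m + target m).
Proof. by rewrite /nf -lock => /negPf ->. Qed.

Lemma Y_eq0 m : ~~ inLM m -> Y m = 0.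
Proof. by move=> mLM; rewrite /Defs.Y insubN // mem_LMs. Qed.

Lemma supp_in_Y m : supp_in (fun t => inTM r s W t) (Y m).
Proof.
rewrite /Defs.Y; case: insubP => [b _ _|_]; last exact: supp_in0.
apply: supp_inN; apply: supp_in_sum => t _ _; apply: supp_inZ; apply: supp_inX.
by have := valP t; rewrite mem_filter => /andP[].
Qed.

Lemma red_mul_sigma p (k : 'I_n) : red (p * sigma k)
  = \sum_(t : seq_sub (seeds r s W k)) theta K t *: red (p * 'X_[val t]).
Proof. exact: lext_mul_sumX. Qed.

Lemma supp_in_sigma (A : 'X_{1..n} -> Prop) w (k : 'I_n) :
  (forall u, u \in seeds r s W k -> A (w + u)%MM) -> supp_in A ('X_[w] * sigma k).
Proof.
move=> Aw; apply: supp_inXM; apply: supp_in_sum => t _ _; apply: supp_inZ.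
by apply: supp_inX; apply: Aw; apply: valP.
Qed.

Lemma init_target_big m : (s < mdeg m)%N -> init_target m = 0.
Proof. by rewrite /Defs.init_target ltnNge => /negPf ->. Qed.

Lemma supp_in_init_target m : ~~ inO m -> supp_in (fun m' => later m m') (init_target m).
Proof.
move=> mO; case: (leqP (mdeg m) s) => [le_s|/init_target_big->]; last exact: supp_in0.
rewrite /Defs.init_target le_s; case lvm: (lv m) => [k|]; last exact: supp_in0.
apply: supp_in_sum => m' m'p _; apply: supp_inZ; apply: supp_inX; move: m' m'p.
apply: supp_in_sigma => u uk; apply: (seed_later adm) uk => //.
by rewrite lvm.
Qed.

Lemma ndeglex_total : total (@ndeglex n).
Proof.
move=> m m'; rewrite /ndeglex; case: ltngtP => //= _.
exact: lexle_total.
Qed.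

Lemma ndeglex_trans : transitive (@ndeglex n).
Proof.
move=> m m1 m2; rewrite /ndeglex.
case/orP => [lt1|/andP[/eqP-> l1]] /orP[lt2|/andP[/eqP eq2 l2]].
- by rewrite (ltn_trans lt1).
- by rewrite -eq2 lt1.
- by rewrite lt2.
- by rewrite eq2 eqxx (lexle_trans l2 l1) orbT.
Qed.

(** The initial target involves only monomials later than m, and on these the accumulator at the
    step for m already agrees with the final target. *)
Lemma targetE m : ~~ inO m -> target m = red (init_target m).
Proof.
move=> mO; rewrite /Defs.target.
pose step m f m' : P := if m' == m then rewrite_with K r s W f (init_target m) else f m'.
have catE l1 l2 m' : m' \notin l1 ->
    foldr step (fun=> 0) (l1 ++ l2) m' = foldr step (fun=> 0) l2 m'.
  elim: l1 => //= x l1 IH; rewrite inE negb_or => /andP[/negPf neq /IH <-].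
  by rewrite /step neq.
(* A monomial outside O that the listing misses has degree above s, so its initial target is 0. *)
have [mN|mN] := boolP (m \in Ns r s W); last first.
  rewrite init_target_big ?raddf0.
    by have := catE _ [::] _ mN; rewrite cats0.
  rewrite ltnNge; apply: contra mN => le_s.
  rewrite mem_sort mem_filter mem_mons (leqW le_s) andbT /Defs.inN.
  by rewrite (leqW le_s) (notinO_deg adm mO).
have uniqN : uniq (Ns r s W).
  rewrite sort_uniq filter_uniq // map_inj_uniq ?enum_uniq //.
  exact: val_inj.
have sortN : sorted (@ndeglex n) (Ns r s W) by apply/sort_sorted/ndeglex_total.
have EN : target =1 foldr step (fun=> 0) (Ns r s W) by [].
case/splitPr: mN uniqN sortN EN => l1 l2 uniqN sortN EN.
move: uniqN; rewrite cat_uniq /= negb_or => /and3P[_ /andP[ml1 _] /andP[ml2 _]].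
rewrite catE //= [in LHS]/step eqxx; apply: eq_lext => m' /(supp_in_init_target mO) lat.
rewrite /nf -lock; case: ifP => // _; rewrite EN catE /= /step.
  case: eqP => // eq_m; move: lat; rewrite eq_m /later /ndeglex eqxx.
  by rewrite /lexle lexx orbT.
apply: contra lat => m'l1; move: sortN; rewrite (sorted_pairwise ndeglex_trans).
rewrite pairwise_cat => /andP[/allrelP + _]; apply=> //.
exact: mem_head.
Qed.

Lemma nf_big m : (s < mdeg m)%N -> nf m = 0.
Proof.
move=> lt_s; have mO : ~~ inO m by apply: contraL lt_s => /(inO_deg adm); rewrite -leqNgt.
rewrite nf_notinO // Y_eq0; last by apply: contraL lt_s => /inLM_deg; rewrite -leqNgt.
by rewrite targetE // init_target_big // raddf0 addr0 oppr0.
Qed.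

Lemma red_big p : supp_in (fun m => (s < mdeg m)%N) p -> red p = 0.
Proof. by move=> big_p; apply: lext_eq0; apply: supp_inS _ big_p => m /nf_big. Qed.

Lemma later_le m m' : later m m' -> (mdeg m <= mdeg m')%N.
Proof. by rewrite laterE => /orP[/ltnW|/andP[/eqP-> _]]. Qed.

(** Reduction never lowers degrees: [Y m] lives in degree s, and the target is reduced from later
    monomials. *)
Lemma supp_in_nf m : supp_in (fun m' => inO m' && (mdeg m <= mdeg m')%N) (nf m).
Proof.
move: m; apply: (@later_ind n s) => [m /nf_big ->|m le_s IH]; first exact: supp_in0.
case: (boolP (inO m)) => mO; first by rewrite nf_inO //; apply: supp_inX; rewrite mO /=.
rewrite nf_notinO //; apply: supp_inN; apply: supp_inD.
  by apply: supp_inS _ (supp_in_Y (m := m)) => t /andP[tO /eqP td]; rewrite tO td.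
rewrite targetE //; apply: supp_in_lext => m' /(supp_in_init_target mO) lat.
apply: supp_inS _ (IH _ lat) => m'' /andP[m''O le_d].
by rewrite m''O (leq_trans (later_le lat) le_d).
Qed.

Lemma seeds_key (k : 'I_n) u : u \in seeds r s W k -> key r s W k.
Proof. by rewrite /seeds; case: (key _ _ _ _). Qed.

(** The terms deleted from the initial target have degree above s, and reduction kills them
    anyway. *)
Lemma red_init_target m (k : 'I_n) : (mdeg m <= s)%N -> lv m == Some k ->
  red (init_target m) = red ('X_[m - U_(k) *+ ek k] * sigma k).
Proof.
move=> le_s /eqP lvm; rewrite /Defs.init_target le_s lvm.
set p := _ * _; rewrite linear_sum [RHS](bigID (fun m' => mdeg m' <= s)%N) /=.
rewrite [X in _ + X]big1 ?addr0; last first.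
  by move=> m'; rewrite -ltnNge => /nf_big ->; rewrite scaler0.
by apply: eq_bigr => m' _; rewrite linearZ /= lextX.
Qed.

(** The bound on e_k is assumed rather than taken from [ek_le], which is limited to degree at most
    s; above degree s both sides vanish. *)
Lemma nfE m (k : 'I_n) : ~~ inO m -> lv m == Some k -> (ek k <= m k)%N ->
  nf m = - Y m - red ('X_[m - U_(k) *+ ek k] * sigma k).
Proof.
move=> mO lvm le_e; case: (leqP (mdeg m) s) => [le_s|lt_s].
  by rewrite nf_notinO // targetE // opprD (red_init_target le_s lvm).
rewrite nf_big // Y_eq0; last by apply: contraL lt_s => /inLM_deg; rewrite -leqNgt.
rewrite red_big ?oppr0 ?addr0 //; apply: supp_in_sigma => u uk.
have := seed_deg adm (seeds_key uk) uk.
have le_m : (U_(k) *+ ek k <= m)%MM.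
  by apply/mnm_lepP => i; rewrite mulmnE mnm1E; case: eqP => [<-|]; rewrite ?mul1n.
have := congr1 mdeg (submK le_m); rewrite !mdegD mdegMn mdeg1; lia.
Qed.

(** * Compatibility of reduction with multiplication *)

Definition red_mulX m := forall u, red ('X_[u] * nf m) = nf (u + m)%MM.

Lemma red_mulX_inO m : inO m -> red_mulX m.
Proof. by move=> mO u; rewrite nf_inO // -mpolyXD lextX. Qed.

Lemma red_mulX_big m : (s < mdeg m)%N -> red_mulX m.
Proof.
by move=> lt_s u; rewrite nf_big // mulr0 raddf0 nf_big // mdegD ltn_addl.
Qed.

Lemma red_nf m : red (nf m) = nf m.
Proof.
rewrite [RHS]mpolyE; apply: eq_big_seq => m' /supp_in_nf /andP[m'O _].
by rewrite (nf_inO m'O).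
Qed.

(** Split off one variable x_l of u: both x_l m and the monomials of x_l [nf m] have degree above
    deg m, so they are later than m and the induction hypothesis handles the remaining factor. Only
    variables dividing u are asked for, as the induction on variables knows just the smaller
    ones. *)
Lemma red_mulX_vars m u : (forall m', later m m' -> red_mulX m') ->
    (forall l : 'I_n, (0 < u l)%N -> red ('X_[U_(l)] * nf m) = nf (U_(l) + m)%MM) ->
  red ('X_[u] * nf m) = nf (u + m)%MM.
Proof.
move=> IH; elim: {u}(mdeg u) {-2}u (erefl (mdeg u)) => [|d IHd] u ud vars.
  by move/eqP: ud; rewrite mdeg_eq0 => /eqP->; rewrite mpolyX0 mul1r add0m red_nf.
have [l /lvP[ul _]] : exists l, lv u == Some l.
  by apply: lv_neq0; rewrite -mdeg_eq0 ud.
have le_l : (U_(l) <= u)%MM by apply/mnm_lepP => i; rewrite mnm1E; case: eqP => // <-.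
rewrite -(submK le_l) -addmA mpolyXD -mulrA -(IH (U_(l) + m)%MM); last first.
  by apply: later_deg; rewrite mdegD mdeg1.
rewrite -(vars _ ul); apply: esym; apply: lext_mul_lext; apply: supp_inXM; apply: supp_inS _ (supp_in_nf (m := m)) => m' /andP[_ le_d].
by apply: IH; apply: later_deg; rewrite mdegD mdeg1.
Qed.

Lemma red_mul_Y u m : (0 < mdeg u)%N -> red ('X_[u] * Y m) = 0.
Proof.
move=> u0; apply: red_big; apply: supp_inXM; apply: supp_inS _ (supp_in_Y (m := m)) => t.
by case/andP=> _ /eqP td; rewrite mdegD td; lia.
Qed.

Lemma red_mulX_all m : red_mulX m.
Proof.
move: m; apply: (@later_ind n s) => [|m le_s IH]; first exact: red_mulX_big.
case: (boolP (inO m)) => [|mO]; first exact: red_mulX_inO.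
have m_gt0 := notinO_gt0 adm mO.
have [k lvm] : exists k, lv m == Some k by apply: lv_neq0; rewrite -mdeg_eq0; lia.
have le_e := ek_le adm mO le_s lvm; have kk := keyP adm mO le_s lvm.
have le_m : (U_(k) *+ ek k <= m)%MM.
  by apply/mnm_lepP => i; rewrite mulmnE mnm1E; case: eqP => [<-|]; rewrite ?mul1n.
set w := (m - U_(k) *+ ek k)%MM in le_m *.
have redX u : (0 < mdeg u)%N -> red ('X_[u] * nf m) = - red ('X_[u] * ('X_[w] * sigma k)).
  move=> u0; rewrite (nfE mO lvm le_e) mulrBr mulrN linearB /= linearN /=.
  rewrite red_mul_Y // oppr0 sub0r lext_mul_lext //.
  by apply: supp_in_sigma => v vk; apply/IH/(seed_later adm).
move=> u; apply: red_mulX_vars => // j _; move: u => _.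
(* Smaller variables have larger indices, so induction on n - j starts from x_n. *)
elim/ltn_ind: {j}(n - j)%N {-2}j (erefl (n - j)%N) => d IHd j jd.
rewrite redX ?mdeg1 //; case: (leqP k j) => [le_kj|lt_jk].
  (* The largest variable stays x_k, so removing x_k^(e_k) from x_j m leaves x_j w. *)
  have jmk : lv (U_(j) + m)%MM == Some k.
    case/lvP: lvm => mk m0; apply/lvP; split=> [|i lt_i]; rewrite mnmDE ?ltn_addl //.
    by rewrite m0 // mnm1E -val_eqE gtn_eqF //= (leq_trans lt_i).
  rewrite (nfE (notinOD adm _ mO) jmk); last by rewrite mnmDE; lia.
  by rewrite (Y_eq0 (notinLMD _ mO)) oppr0 sub0r mulrA -mpolyXD addmBA.
(* If deg m >= s, both sides reduce from terms of degree above s. *)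
have [lt_s|lt_s] := leqP s (mdeg m).
  rewrite nf_big ?mdegD ?mdeg1 // red_big ?oppr0 //; apply: supp_inXM.
  apply: supp_in_sigma => v vk; rewrite mdegD mdeg1.
  by have := later_le (seed_later adm mO le_s lvm vk); rewrite -/w; lia.
have lvj (v : 'X_{1..n}) : (forall i : 'I_n, (i <= j)%N -> v i = 0%N) ->
    lv (U_(j) + v)%MM == Some j /\ (U_(j) + v)%MM j = 1%N.
  move=> v0; split; last by rewrite mnmDE mnm1E eqxx v0.
  apply/lvP; split=> [|i lt_i]; rewrite mnmDE mnm1E ?eqxx //.
  by rewrite v0 ?(ltnW lt_i) // -val_eqE gtn_eqF.
have m0 (i : 'I_n) : (i <= j)%N -> m i = 0%N.
  by case/lvP: lvm => _ m0 le_i; apply: m0; apply: leq_ltn_trans lt_jk.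
(* x_j is larger than lv m, and e_j = 1: both sides are red (X^w sigma_k sigma_j) up to sign. *)
have [lvjm jm1] := lvj m m0.
have jmO := notinOD adm U_(j) mO; have jms : (mdeg (U_(j) + m) <= s)%N.
  by rewrite mdegD mdeg1.
have kj := keyP adm jmO jms lvjm.
(* x_j m lies outside O and contains its largest variable x_j exactly once. *)
have ej : ek j = 1%N.
  by have := ek_le adm jmO jms lvjm; have := ek_gt0 adm kj; rewrite jm1; lia.
have nfj v : ~~ inO (U_(j) + v)%MM -> ~~ inLM (U_(j) + v)%MM ->
    (forall i : 'I_n, (i <= j)%N -> v i = 0%N) ->
    nf (U_(j) + v)%MM = - red ('X_[v] * sigma j).
  move=> vO vLM v0; have [lvv v1] := lvj v v0.
  rewrite (nfE vO lvv) ?ej ?v1 // Y_eq0 // oppr0 sub0r mulm1n.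
  by rewrite addmC addmK.
rewrite (nfj m jmO (notinLMD _ mO) m0); apply: congr1.
transitivity (- red ('X_[w] * sigma k * sigma j)).
  rewrite mulrA [X in - lext _ X]mulrAC !red_mul_sigma -sumrN; apply: eq_bigr => t _.
  rewrite -scalerN; congr (_ *: _).
  (* For a seed t of x_k, the monomial w t involves only variables smaller than x_j and has degree
     at least deg m, so [notin_up] lets [nfj] rewrite x_j w t through sigma_j. *)
  rewrite [X in - lext _ X]mulrAC -!mpolyXD lextX -addmA.
  have tk := valP t; have le_d := later_le (seed_later adm mO le_s lvm tk).
  have [O' LM'] := notin_up adm mO lvm lt_jk le_d.
  rewrite nfj // => i le_i; rewrite mnmDE mnmBE m0 // (seed_var adm kk tk) //.
  exact: leq_ltn_trans lt_jk.
rewrite !red_mul_sigma -sumrN; apply: eq_bigr => t _.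
have tj := valP t; have := seed_deg adm kj tj; rewrite ej => t_gt0.
rewrite -scalerN -mpolyXD lextX; congr (_ *: _).
(* A seed t of x_j is not 1 and, as e_j = 1, involves only variables smaller than x_j; [redX] and
   the induction on variables therefore apply to t m. *)
rewrite mulrC addmC -redX // red_mulX_vars //.
move=> l tl; apply: IHd (erefl _); rewrite -jd ltn_sub2l //.
rewrite ltn_neqAle; apply/andP; split.
  apply/eqP => /val_inj jl; move: tl; rewrite -jl.
  by have := seed_key adm kj tj; rewrite ej ltnS leqn0 => /eqP ->.
by rewrite leqNgt; apply/negP => lt_l; move: tl; rewrite (seed_var adm kj tj).
Qed.

End NormalForm.

Theorem proposition2 (K : closedFieldType) (char0 : [pchar K] =i pred0)
  (n r s : nat) (W : nat -> 'X_{1..n}) (adm : admissible r s W)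
  (m1 m2 : 'X_{1..n}) (m1N : inN r s W m1) (m2N : inN r s W m2)
  (a b : option 'I_n) (ab : ~ (a = None /\ b = None))
  (eq12 : (xvar a + m1)%MM = (xvar b + m2)%MM) :
  red K r s W ('X_[xvar a] * (Y K r s W m1 + target K r s W m1)
               - 'X_[xvar b] * (Y K r s W m2 + target K r s W m2)) = 0.
Proof.
have redE p : red K r s W p = lext (nf K r s W) p.
  by apply: eq_lext => m _; rewrite /nf -lock.
have nfN m : inN r s W m -> Y K r s W m + target K r s W m = - nf K r s W m.
  by case/andP => _ mO; rewrite nf_notinO // opprK.
by rewrite !nfN // !mulrN redE linearB !linearN /= !(red_mulX_all K adm) eq12 subrr.
Qed.
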